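(* Let $(X_1,\mu_1)$ and $(X_2,\mu_2)$ be Polish measure spaces, and let $c:X_1\times X_2\to\mathbb{R}$ be a continuous cost function with $-c(X_1\times X_2)=[a,b)$. Fix $\lambda\in(0,1)$. Let $F:[a,b]\to[0,\infty)$ be continuous and non-decreasing with $F(a)=0$, and assume that $(X_1,\mu_1)$ and $(X_2,\mu_2)$ satisfy the cost-Santaló inequality associated with $(\lambda,c,F)$ with domain $(\mathcal{A}_1,\mathcal{A}_2)$. Let $\Phi_1:X_1\to[a,b]$ and $\Phi_2:X_2\to[a,b]$ be measurable functions satisfying $$\lambda\Phi_1(x_1)+(1-\lambda)\Phi_2(x_2)\ge-c(x_1,x_2)\qquad\text{for all }x_1\in X_1,\ x_2\in X_2.$$ Let $\Omega:[a,b]\to(0,\infty)$ be a continuous, non-increasing, log-concave function such that $$Z_1=\int_{X_1}\Omega(\Phi_1)\,d\mu_1\quad\text{and}\quad Z_2=\int_{X_2}\Omega(\Phi_2)\,d\mu_2$$ satisfy $0<Z_1,Z_2<+\infty$, and assume the balance condition $$\int_a^b\Omega(r)\,dF(r)\le Z_1^\lambda Z_2^{1-\lambda}.$$ Define the probability measures $dP_i=Z_i^{-1}\Omega(\Phi_i)\,d\mu_i$ on $X_i$, $i=1,2$, and the transport cost $$c_\Omega(x_1,x_2)=\log\left(\frac{\Omega(-c(x_1,x_2))^{\frac1{1-\lambda}}}{\Omega(\Phi_1(x_1))^{\frac{\lambda}{1-\lambda}}\,\Omega(\Phi_2(x_2))}\right).$$ Then $c_\Omega\ge0$, and for any $\nu_1\in\mathcal{P}(X_1)$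 having a density with respect to $P_1$ and $\nu_2\in\mathcal{P}(X_2)$ having a density with respect to $P_2$, $$\mathcal{T}^{\mathcal{A}}_{c_\Omega}(\nu_1,\nu_2)\le\frac{\lambda}{1-\lambda}H(\nu_1|P_1)+H(\nu_2|P_2).$$
   Context: A Polish measure space is a complete separable metric space with a Borel measure; measurable means Borel measurable. $\mathcal{A}_i$ is a collection of measurable subsets of $X_i$, and $\mathcal{F}(\mathcal{A}_i)$ is the set of measurable $f:X_i\to[0,\infty)$ with $\{f\ge r\}\in\mathcal{A}_i$ for a.e. $r\in(0,\|f\|_\infty)$. The cost-Santaló inequality associated with $(\lambda,c,F)$ with domain $(\mathcal{A}_1,\mathcal{A}_2)$ means that the following two equivalent statements hold: (i) $\mu_1(A_1)^\lambda\mu_2(A_2)^{1-\lambda}\le F(\sup_{x_1\in A_1,x_2\in A_2}-c(x_1,x_2))$ for all non-empty $A_1\in\mathcal{A}_1$, $A_2\in\mathcal{A}_2$; (ii) for all $f\in\mathcal{F}(\mathcal{A}_1)$, $g\in\mathcal{F}(\mathcal{A}_2)$ and measurable non-increasing $\Omega:(a,b]\to[0,\infty)$ with $f(x_1)^\lambda g(x_2)^{1-\lambda}\le\Omega(-c(x_1,x_2))$ whenever $-c(x_1,x_2)\in(a,b]$, one has $(\int f\,d\mu_1)^\lambda(\int g\,d\mu_2)^{1-\lambda}\le\int_a^b\Omega(r)\,dF(r)$. Here $dF$ is the Lebesgue–Stieltjes measure of $F$; when $b=\infty$, $[a,b]$ means $[a,\infty)$ and $F(\infty)$ means $\lim_{r\to\infty}F(r)$;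 $0\cdot\infty=0$. $\mathcal{P}(X)$ is the set of Borel probability measures on $X$; $H(\nu|\mu)=\int f\log f\,d\mu$ if $d\nu=f\,d\mu$ and $+\infty$ otherwise. The restricted Kantorovich cost $\mathcal{T}^{\mathcal{A}}_{c_\Omega}(\nu_1,\nu_2)$ is the supremum of $\int_{X_1}\varphi\,d\nu_1+\int_{X_2}\psi\,d\nu_2$ over $\varphi\in L^1(\nu_1)$, $\psi\in L^1(\nu_2)$ with $\varphi(x_1)+\psi(x_2)\le c_\Omega(x_1,x_2)$ for all $x_1,x_2$, subject to $e^{\frac{1-\lambda}{\lambda}\varphi}\,\Omega(\Phi_1(\cdot))\in\mathcal{F}(\mathcal{A}_1)$ and $e^{\psi}\,\Omega(\Phi_2(\cdot))\in\mathcal{F}(\mathcal{A}_2)$. *)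

(* Defs.v *)
From HB Require Import structures.
From mathcomp Require Import all_boot all_order all_algebra.
From mathcomp Require Import all_classical all_reals all_analysis.

Set Implicit Arguments.
Unset Strict Implicit.
Unset Printing Implicit Defensive.

Import Order.TTheory GRing.Theory Num.Theory.
Import numFieldNormedType.Exports.

Local Open Scope classical_set_scope.
Local Open Scope ring_scope.

HB.mixin Record isSeparable T & Topological T := {
  separable_subproof : exists2 D : set T, countable D & dense D
}.

(* Complete separable metric spaces. The library's completeness structure
   carries a base point, so these spaces are nonempty. *)
#[short(type="polishMetricType")]
HB.structure Definition PolishMetric (R : numDomainType) :=
  { T of Metric R T & Complete T & isSeparable T }.

Notation borel X := (g_sigma_algebraType (@open X)).

Section intervals.
Context {R : realType}.

(* Intervals of reals with a possibly infinite right endpoint b; for b = +oo,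
   both [a, b] and [a, b[ are [a, +oo[, and ]a, b] is ]a, +oo[. *)
Definition icc (a : R) (b : \bar R) : set R :=
  [set r | (a%:E <= r%:E)%E /\ (r%:E <= b)%E].

Definition ico (a : R) (b : \bar R) : set R :=
  [set r | (a%:E <= r%:E)%E /\ (r%:E < b)%E].

Definition ioc (a : R) (b : \bar R) : set R :=
  [set r | (a%:E < r%:E)%E /\ (r%:E <= b)%E].

(* The nearest-point retraction of the line onto [a, b] (onto a point when
   [a, b] is empty). *)
Definition clamp (a : R) (b : \bar R) (r : R) : R :=
  match b with
  | b'%:E => Num.min (Num.max a r) b'
  | +oo => Num.max a r
  | -oo => a
  end%E.

End intervals.

(* Continuous nondecreasing functions on [a, b]; the values outside of [a, b]
   are irrelevant. *)
Record growth_fun (R : realType) (a : R) (b : \bar R) := GrowthFun {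
  growth_val :> R -> R ;
  growth_continuous : {within icc a b, continuous growth_val} ;
  growth_nondecreasing :
    {in icc a b &, {homo growth_val : x y / x <= y}}
}.

Section stieltjes.
Context {R : realType} {a : R} {b : \bar R}.
Implicit Types F : growth_fun a b.

Lemma clamp_icc r : (a%:E <= b)%E -> icc a b (clamp a b r).
Proof.
rewrite /icc /clamp; case: b => [b'| |] //=; rewrite ?lee_fin => ab.
- by rewrite le_min ab le_max lexx ge_min lexx orbT.
- by rewrite le_max lexx leey.
Qed.

Lemma clamp_nondecreasing : {homo clamp a b : x y / x <= y}.
Proof.
move=> x y xy; rewrite /clamp.
have m : Num.max a x <= Num.max a y by rewrite ge_max !le_max lexx xy orbT.
case: b => [b'| |] //.
by rewrite le_min !ge_min m lexx orbT.
Qed.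

Lemma clamp_continuous : continuous (clamp a b).
Proof.
have cm : continuous (Num.max a : R -> R).
  by move=> x; apply: (@continuous_max _ _ (cst a) id);
    [exact: cst_continuous|exact: cvg_id].
rewrite /clamp; case: b => [b'| |] //.
- move=> x; apply: (@continuous_min _ _ (fun r : R => Num.max a r) (cst b'));
    [exact: cm|exact: cst_continuous].
- exact: cst_continuous.
Qed.

Lemma clamp_empty x y : ~~ (a%:E <= b)%E -> clamp a b x = clamp a b y.
Proof.
rewrite /clamp; case: b => [b'| |] //=; rewrite -?ltNge ?lte_fin.
- move=> ba; have m r : Num.min (Num.max a r) b' = b'.
    by apply/min_idPr; rewrite (le_trans (ltW ba))// le_max lexx.
  by rewrite !m.
- by rewrite ltNge leey.
Qed.

(* The extension of F to the line that is constant on each side of [a, b]. *)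
Definition growth_ext F : R -> R := F \o clamp a b.

Lemma growth_ext_nondecreasing F : nondecreasing (growth_ext F).
Proof.
move=> x y xy; have [ab|ab] := boolP (a%:E <= b)%E; last first.
  by rewrite /growth_ext/= (clamp_empty x y ab).
apply: growth_nondecreasing; rewrite ?inE;
  [exact: clamp_icc|exact: clamp_icc|exact: clamp_nondecreasing].
Qed.

Lemma growth_ext_continuous F : continuous (growth_ext F).
Proof.
have [ab|ab] := boolP (a%:E <= b)%E; last first.
  have -> : growth_ext F = cst (growth_ext F 0).
    by apply/funext => x; rewrite /growth_ext/= (clamp_empty x 0 ab).
  exact: cst_continuous.
move=> x; have ix := clamp_icc x ab.
have Fc := @growth_continuous _ _ _ F (clamp a b x).
move=> V FV; have : within (icc a b) (nbhs (clamp a b x)) (F @^-1` V).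
  by rewrite nbhs_subspace_in//; exact: Fc.
move=> /clamp_continuous; apply: (@filterS _ (nbhs x)) => y; apply.
exact: clamp_icc.
Qed.

HB.instance Definition _ F := isCumulative.Build R _ R (growth_ext F)
  (@growth_ext_nondecreasing F)
  (right_continuousW (@growth_ext_continuous F)).

(* The measure dF. It has no mass outside of ]a, b] (F is continuous, so there
   are no atoms), and \int_a^b is rendered by an integral over ]a, b]. *)
Definition stieltjes F : {measure set (measurableTypeR R) -> \bar R} :=
  lebesgue_stieltjes_measure (growth_ext F).

(* The value of F at a point of [a, b] in the extended reals, with
   F(+oo) = lim_(r -> +oo) F(r). *)
Definition growth_ereal F (s : \bar R) : \bar R :=
  match s with
  | r%:E => (F r)%:E
  | +oo => lim ((F r)%:E @[r --> +oo%R])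
  | -oo => 0
  end%E.

End stieltjes.

Section cost_santalo.
Context {R : realType}.

(* The class F(A); its definition refers to no measure, and the norm of f is
   its supremum (possibly +oo), not an essential supremum. *)
Definition level_class d (T : measurableType d) (A : set (set T))
    (f : T -> R) : Prop :=
  [/\ measurable_fun setT f,
      forall x, 0 <= f x &
      {ae @lebesgue_measure R, forall r : R,
        0 < r -> (r%:E < ereal_sup (range (EFin \o f)))%E ->
        A [set x | r <= f x]}].

Context {d1 d2 : measure_display}.
Context {T1 : measurableType d1} {T2 : measurableType d2}.

Definition cost_santalo_sets (mu1 : {measure set T1 -> \bar R})
    (mu2 : {measure set T2 -> \bar R}) (A1 : set (set T1)) (A2 : set (set T2))
    (lam : R) (c : T1 -> T2 -> R) (a : R) (b : \bar R) (F : growth_fun a b) :=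
  forall B1 B2, A1 B1 -> A2 B2 -> B1 !=set0 -> B2 !=set0 ->
    (mu1 B1 `^ lam * mu2 B2 `^ (1 - lam) <=
     growth_ereal F (ereal_sup [set (- c x1 x2)%:E | x1 in B1 & x2 in B2]))%E.

Definition cost_santalo_functions (mu1 : {measure set T1 -> \bar R})
    (mu2 : {measure set T2 -> \bar R}) (A1 : set (set T1)) (A2 : set (set T2))
    (lam : R) (c : T1 -> T2 -> R) (a : R) (b : \bar R) (F : growth_fun a b) :=
  forall (f : T1 -> R) (g : T2 -> R) (Omega : R -> R),
    level_class A1 f -> level_class A2 g ->
    measurable_fun (ioc a b) Omega ->
    (forall r, ioc a b r -> 0 <= Omega r) ->
    {in ioc a b &, {homo Omega : x y /~ x <= y}} ->
    (forall x1 x2, ioc a b (- c x1 x2) ->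
      f x1 `^ lam * g x2 `^ (1 - lam) <= Omega (- c x1 x2)) ->
    ((\int[mu1]_x (f x)%:E) `^ lam * (\int[mu2]_x (g x)%:E) `^ (1 - lam) <=
     \int[stieltjes F]_(r in ioc a b) (Omega r)%:E)%E.

(* The sets form and the functions form are equivalent; the inequality asserts
   that both hold. *)
Definition cost_santalo mu1 mu2 A1 A2 lam c a b (F : growth_fun a b) :=
  cost_santalo_sets mu1 mu2 A1 A2 lam c F /\
  cost_santalo_functions mu1 mu2 A1 A2 lam c F.

End cost_santalo.

Section entropy.
Context {R : realType} {d : measure_display} {T : measurableType d}.
Implicit Types mu nu : {measure set T -> \bar R}.

(* d nu = f d mu *)
Definition is_density mu nu (f : T -> R) : Prop :=
  [/\ measurable_fun setT f,
      forall x, 0 <= f x &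
      forall A, measurable A -> nu A = (\int[mu]_(x in A) (f x)%:E)%E].

(* H(nu | mu); since ln 0 = 0, f * ln f vanishes where f does. *)
Definition relative_entropy nu mu : \bar R :=
  match pselect (exists f, is_density mu nu f) with
  | left h => let f := sval (cid h) in
              (\int[mu]_x (f x * ln (f x))%:E)%E
  | right _ => +oo%E
  end.

End entropy.

Section transport.
Context {R : realType} {d1 d2 : measure_display}.
Context {T1 : measurableType d1} {T2 : measurableType d2}.
Variables (lam : R) (c : T1 -> T2 -> R) (Omega : R -> R).
Variables (Phi1 : T1 -> R) (Phi2 : T2 -> R).

Definition cost_Omega (x1 : T1) (x2 : T2) : R :=
  ln (Omega (- c x1 x2) `^ (1 - lam)^-1 /
      (Omega (Phi1 x1) `^ (lam / (1 - lam)) * Omega (Phi2 x2))).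

Variables (A1 : set (set T1)) (A2 : set (set T2)).

Definition restricted_kantorovich (nu1 : {measure set T1 -> \bar R})
    (nu2 : {measure set T2 -> \bar R}) : \bar R :=
  ereal_sup [set v | exists (phi : T1 -> R) (psi : T2 -> R),
    [/\ nu1.-integrable setT (EFin \o phi) /\
          nu2.-integrable setT (EFin \o psi),
        forall x1 x2, phi x1 + psi x2 <= cost_Omega x1 x2,
        level_class A1 (fun x => expR ((1 - lam) / lam * phi x) *
                                 Omega (Phi1 x)),
        level_class A2 (fun x => expR (psi x) * Omega (Phi2 x)) &
        v = (\int[nu1]_x (phi x)%:E + \int[nu2]_x (psi x)%:E)%E]].

End transport.

(* Main.v *)
(** Let (phi, psi) be admissible in the restricted Kantorovich problem, and put
    f = e^((1-lam)/lam phi) Omega(Phi1) and g = e^psi Omega(Phi2). The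
    constraint phi + psi <= c_Omega says exactly that
    f(x1)^lam g(x2)^(1-lam) <= Omega(-c(x1, x2)), so the functional
    cost-Santalo inequality and the balance condition give
    (int f dmu1 / Z1)^lam (int g dmu2 / Z2)^(1-lam) <= 1, where the two ratios
    are int e^((1-lam)/lam phi) dP1 and int e^psi dP2. The Gibbs variational
    inequality int phi dnu <= H(nu|P) + log int e^phi dP, applied to
    (1-lam)/lam phi and to psi, then bounds int phi dnu1 + int psi dnu2. *)

Require Import Defs.
From HB Require Import structures.
From mathcomp Require Import all_boot all_order all_algebra.
From mathcomp Require Import all_classical all_reals all_analysis.
From mathcomp Require Import measurable_realfun.
From mathcomp Require Import ring lra.
Import Order.TTheory GRing.Theory Num.Theory.
Import numFieldNormedType.Exports.
Local Open Scope classical_set_scope.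
Local Open Scope ring_scope.

(** * Integration against a measure with a density *)

Section density.
Local Open Scope ereal_scope.
Context {d} {T : measurableType d} {R : realType}.
Context {mu nu : {measure set T -> \bar R}} {f : T -> R}.
Hypothesis nuf : is_density mu nu f.
Import HBNNSimple.

(** Splitting [h] over its finitely many level sets reduces the claim to indicators, where it is the
    defining property of the density. *)
Lemma integral_density_nnsfun (h : {nnsfun T >-> R}) :
  \int[nu]_x (h x)%:E = \int[mu]_x (h x * f x)%:E.
Proof.
have [mf f0 nuE] := nuf.
transitivity (\int[nu]_x
    (\sum_(y \in range h) (y * \1_(h @^-1` [set y]) x)%:E)).
  by apply: eq_integral => t _; rewrite /= fimfunE -fsumEFin.
rewrite ge0_integral_fsum//; last 2 first.
- by move=> y; apply/measurable_EFinP; exact: measurable_funM.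
- by move=> y x _; exact: nnfun_muleindic_ge0.
transitivity (\int[mu]_x
    (\sum_(y \in range h) (y * \1_(h @^-1` [set y]) x * f x)%:E)); last first.
  apply: eq_integral => t _; rewrite [in RHS]fimfunE EFinM -fsumEFin//.
  by rewrite ge0_mule_fsuml// => y; exact: nnfun_muleindic_ge0.
rewrite ge0_integral_fsum//; last 2 first.
- by move=> y; apply/measurable_EFinP; do 2 apply: measurable_funM => //.
- move=> y x _; rewrite EFinM mule_ge0// ?lee_fin//.
  exact: nnfun_muleindic_ge0.
apply: eq_fsbigr => y /[!inE] -[t _ <-].
rewrite integralZl_indic_nnsfun// integral_indic// setIT nuE//.
rewrite integral_mkcond -ge0_integralZl//.
- apply: eq_integral => x _; rewrite patchE indicE.
  by case: ifP => _; rewrite ?mulr1 ?mulr0 ?mul0r ?mule0.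
- by apply/(measurable_restrictT _ _).1 => //;
    apply/measurable_EFinP/measurable_funTS.
- by move=> x _; rewrite patchE; case: ifP => // _; rewrite lee_fin.
- by rewrite lee_fin.
Qed.

(** Monotone convergence on both sides, along simple functions increasing to [g]; multiplying by
    [f >= 0] keeps the sequence monotone. *)
Lemma ge0_integral_density {g : T -> R} :
  measurable_fun setT g -> (forall x, (0 <= g x)%R) ->
  \int[nu]_x (g x)%:E = \int[mu]_x (g x * f x)%:E.
Proof.
have [mf f0 _] := nuf; move=> mg g0.
have mG : measurable_fun setT (EFin \o g) by exact/measurable_EFinP.
pose h := nnsfun_approx measurableT mG.
have hg x : (h n x)%:E @[n --> \oo] --> (g x)%:E.
  by apply: (cvg_nnsfun_approx measurableT mG) => // y _; rewrite /= lee_fin.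
have nnh n x : (0 <= h n x)%R by [].
have mh n : measurable_fun setT (h n) by [].
have ndh x m n : (m <= n)%N -> (h m x <= h n x)%R.
  by move=> mn; exact/lefP/nd_nnsfun_approx.
transitivity (limn (fun n => \int[nu]_x (h n x)%:E)).
  rewrite -monotone_convergence//.
  - by apply: eq_integral => x _; apply/esym/cvg_lim => //; exact: hg.
  - by move=> n; exact/measurable_EFinP.
  - by move=> n x _; rewrite lee_fin.
  - by move=> x _ m n mn; rewrite lee_fin; exact: ndh.
under eq_fun do rewrite integral_density_nnsfun.
rewrite -monotone_convergence//.
- apply: eq_integral => x _; apply/cvg_lim => //; rewrite EFinM.
  by under eq_fun do rewrite EFinM; apply: cvgeZr.
- by move=> n; apply/measurable_EFinP; exact: measurable_funM.
- by move=> n x _; rewrite lee_fin mulr_ge0.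
- by move=> x _ m n mn; rewrite lee_fin ler_wpM2r// ndh.
Qed.

(** Since [f >= 0], the positive and negative parts of [g * f] are those of [g] times [f]. Both
    sides are then the same difference, so [g] may fail to be integrable. *)
Lemma integral_density {g : T -> R} : measurable_fun setT g ->
  \int[nu]_x (g x)%:E = \int[mu]_x (g x * f x)%:E.
Proof.
have [mf f0 _] := nuf => mg; rewrite integralE [RHS]integralE.
have mgp : measurable_fun setT (g^\+)%R by exact: measurable_funrpos.
have mgn : measurable_fun setT (g^\-)%R by exact: measurable_funrneg.
congr (_ - _).
- rewrite (eq_integral (fun x => ((g^\+)%R x)%:E)); last first.
    by move=> x _; rewrite funeposE /funrpos EFin_max.
  rewrite ge0_integral_density//.
  apply: eq_integral => x _.
  by rewrite funeposE /funrpos -EFin_max maxr_pMl// mul0r.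
- rewrite (eq_integral (fun x => ((g^\-)%R x)%:E)); last first.
    by move=> x _; rewrite funenegE /funrneg EFin_max.
  rewrite ge0_integral_density//.
  apply: eq_integral => x _.
  by rewrite funenegE /funrneg -EFin_max maxr_pMl// mul0r mulNr.
Qed.

Lemma integrable_density {g : T -> R} : measurable_fun setT g ->
  nu.-integrable setT (EFin \o g) ->
  mu.-integrable setT (fun x => (g x * f x)%:E).
Proof.
have [mf f0 _] := nuf => mg /integrableP[_ gfin].
apply/integrableP; split.
  by apply/measurable_EFinP; exact: measurable_funM.
rewrite (eq_integral (fun x => (`|g x| * f x)%:E)); last first.
  by move=> x _; rewrite abse_EFin normrM (ger0_norm (f0 x)).
by rewrite -ge0_integral_density//; exact: measurableT_comp.
Qed.

End density.

(** * The Gibbs variational inequality *)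

Lemma le_integral_measurable {d} {T : measurableType d} {R : realType}
    (mu : {measure set T -> \bar R}) (D : set T) (f g : T -> \bar R) :
  measurable D -> measurable_fun D f -> measurable_fun D g ->
  {in D, forall x, (f x <= g x)%E} ->
  (\int[mu]_(x in D) f x <= \int[mu]_(x in D) g x)%E.
Proof.
(* Positive parts grow and negative parts shrink from [f] to [g]. Integrability is not assumed,
   because the entropy integrand [f * ln f] may have infinite integral. *)
move=> mD mf mg fg; rewrite integralE [leRHS]integralE; apply: leeB;
  apply: ge0_le_integral => //;
  do ?[exact: measurable_funepos|exact: measurable_funeneg].
- by move=> x /mem_set; exact: funepos_le.
- by move=> x /mem_set; exact: funeneg_le.
Qed.

(** For [s > 0], divide by [s]: this is [1 + v <= expR v] at [v = t - ln s]. It is the Legendre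
    duality between [expR t] and [s * ln s - s]. *)
Lemma young_xlnx {R : realType} {s : R} (t : R) :
  0 <= s -> (t + 1) * s - expR t <= s * ln s.
Proof.
rewrite le_eqVlt => /predU1P[<-|s0].
  by rewrite mulr0 mul0r sub0r oppr_le0 expR_ge0.
have -> : expR t = s * expR (t - ln s).
  by rewrite expRB lnK ?posrE// mulrCA divff ?mulr1// gt_eqF.
have := ler_wpM2l (ltW s0) (expR_ge1Dx (t - ln s)); lra.
Qed.

(* Integrate Young's inequality [s (t + 1) - e^t <= s ln s] at
   [s = f x, t = phi x - L]. *)
Lemma entropy_duality {d} {T : measurableType d} {R : realType}
    {P nu : probability T R} {phi : T -> R} {L : R} :
  (exists f, is_density P nu f) -> nu.-integrable setT (EFin \o phi) ->
  (\int[P]_x (expR (phi x))%:E <= (expR L)%:E)%E ->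
  (\int[nu]_x (phi x)%:E <= relative_entropy nu P + L%:E)%E.
Proof.
move=> nuP iphi expL; rewrite /relative_entropy; case: pselect => // h.
have := svalP (cid h); set f := sval (cid h) => nuf; have [mf f0 _] := nuf.
have mphi : measurable_fun setT phi.
  by have /integrableP[/measurable_EFinP] := iphi.
(* [u] is the factor [t + 1] of Young's inequality at [t = phi x - L]. *)
pose u x := phi x + (1 - L).
have mu : measurable_fun setT u by exact: measurable_funD.
have i1 : nu.-integrable setT (EFin \o cst (1 - L)).
  exact: finite_measure_integrable_cst.
have iu : nu.-integrable setT (EFin \o u).
  exact: (integrableD measurableT iphi i1).
have Iu : (\int[nu]_x (u x)%:E = \int[nu]_x (phi x)%:E + (1 - L)%:E)%E.
  rewrite (integralD_EFin measurableT iphi i1); congr (_ + _)%E.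
  have -> : EFin \o cst (1 - L) = cst (1 - L)%:E by [].
  by rewrite integral_cst// [X in (_ * X)%E](probability_setT nu) mule1.
have mE : measurable_fun setT (fun x => expR (phi x)).
  exact: measurableT_comp.
have mEL : measurable_fun setT (fun x => expR (phi x - L)).
  by apply: measurableT_comp => //; exact: measurable_funB.
have IE : (\int[P]_x (expR (phi x - L))%:E <= 1)%E.
  rewrite (eq_integral (fun x =>
    (expR (- L))%:E * (expR (phi x))%:E)%E); last first.
    by move=> x _; rewrite -EFinM -expRD addrC.
  rewrite ge0_integralZl//; last exact/measurable_EFinP.
  apply: le_trans (lee_wpmul2l _ expL) _; first by rewrite lee_fin expR_ge0.
  by rewrite -EFinM -expRD addNr expR0.
have iE : P.-integrable setT (EFin \o (fun x => expR (phi x - L))).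
  apply/integrableP; split; first exact/measurable_EFinP.
  rewrite (eq_integral (fun x => (expR (phi x - L))%:E)); last first.
    by move=> x _; rewrite /= ger0_norm ?expR_ge0.
  exact: le_lt_trans IE (ltry _).
have : (\int[P]_x (u x * f x - expR (phi x - L))%:E <=
        \int[P]_x (f x * ln (f x))%:E)%E.
  apply: le_integral_measurable => //.
  - apply/measurable_EFinP; apply: measurable_funB => //.
    exact: measurable_funM.
  - apply/measurable_EFinP; apply: measurable_funM => //.
    exact: measurableT_comp.
  - move=> x _; rewrite lee_fin /u.
    by have := young_xlnx (phi x - L) (f0 x); lra.
have iuf : P.-integrable setT (EFin \o (fun x => u x * f x)).
  exact: (integrable_density nuf).
(* The left side becomes the [nu]-integral of [phi], plus [1 - L], minus an exponential integral
   that is at most 1: the two ones cancel and [L] remains. *)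
rewrite (integralB_EFin measurableT iuf iE).
rewrite -(integral_density nuf)// Iu.
have := integrable_fin_num measurableT iphi.
have := integrable_fin_num measurableT iE.
move: IE => /=.
move: (integral _ _ _) => [e| |]// e1 _.
move: (integral _ _ _) => [p| |]// _.
move: (integral _ _ _) => [H| |]//=; last by rewrite !leey.
by move: e1; rewrite -!EFinD !lee_fin; lra.
Qed.

(** * Logarithmic forms and positivity *)

Lemma cost_OmegaE {R : realType} {d1 d2 : measure_display}
    {T1 : measurableType d1} {T2 : measurableType d2} {lam : R}
    (c : T1 -> T2 -> R) (Omega : R -> R) (Phi1 : T1 -> R) (Phi2 : T2 -> R)
    {x1 x2} : lam < 1 ->
  0 < Omega (- c x1 x2) -> 0 < Omega (Phi1 x1) -> 0 < Omega (Phi2 x2) ->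
  (1 - lam) * cost_Omega lam c Omega Phi1 Phi2 x1 x2 =
  ln (Omega (- c x1 x2)) - lam * ln (Omega (Phi1 x1)) -
  (1 - lam) * ln (Omega (Phi2 x2)).
Proof.
(* The factor [1 - lam] clears the denominators of the exponents, leaving an expression linear in
   the logarithms. *)
move=> lam1 Oc O1 O2; rewrite /cost_Omega ln_div ?posrE ?mulr_gt0 ?powR_gt0//.
rewrite lnM ?posrE ?powR_gt0// !ln_powR; field.
by rewrite subr_eq0 gt_eqF.
Qed.

Lemma measurable_icc {R : realType} (a : R) (b : \bar R) :
  measurable (icc a b).
Proof.
have -> : icc a b = EFin @^-1` [set` `[a%:E, b]].
  by apply/seteqP; split => r /=; rewrite in_itv/= => /andP.
have mEFin : measurable_fun [set: R] (EFin \o id) by exact/measurable_EFinP.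
rewrite -[X in measurable X]setTI.
by apply: mEFin => //; exact: emeasurable_itv.
Qed.

(** A zero integral would make the positive function [expR \o phi] vanish almost everywhere, which
    is impossible for a measure of mass 1. *)
Lemma integral_expR_gt0 {d} {T : measurableType d} {R : realType}
    (P : probability T R) {phi : T -> R} : measurable_fun setT phi ->
  (0 < \int[P]_x (expR (phi x))%:E)%E.
Proof.
move=> mphi; rewrite lt0e integral_ge0 ?andbT; last first.
  by move=> x _; rewrite lee_fin expR_ge0.
apply/eqP => I0.
have mE : measurable_fun setT (fun x => (expR (phi x))%:E).
  by apply/measurable_EFinP; exact: measurableT_comp.
have aeP : ProperFilter (almost_everywhere P).
  apply: ae_properfilter_algebraOfSetsType.
  by rewrite [ltRHS](probability_setT P) lte01.
suff : \forall x \ae P, False by move=> /(@filter_not_empty _ _ aeP).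
have /(ae_eq_integral_abs P measurableT mE) :
    (\int[P]_x `|(expR (phi x))%:E| = 0)%E.
  rewrite -[RHS]I0; apply: eq_integral => x _.
  by rewrite gee0_abs// lee_fin expR_ge0.
by apply: filterS => x /(_ Logic.I) [] /eqP; rewrite gt_eqF// expR_gt0.
Qed.

(** If one of the positive factors were infinite, the product would be too, against the finite
    bound. Both are thus positive reals and logarithms can be taken. *)
Lemma poweR_le_ln {R : realType} {lam z1 z2 : R} {X Y : \bar R} :
  0 < lam -> lam < 1 -> 0 < z1 -> 0 < z2 -> (0 < X)%E -> (0 < Y)%E ->
  (X `^ lam * Y `^ (1 - lam) <= (z1 `^ lam * z2 `^ (1 - lam))%:E)%E ->
  exists x y, [/\ X = x%:E, Y = y%:E &
    lam * ln x + (1 - lam) * ln y <= lam * ln z1 + (1 - lam) * ln z2].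
Proof.
move=> lam0 lam1 z10 z20; have lam10 : 0 < 1 - lam by rewrite subr_gt0.
case: X Y => [x| |] [y| |]//; rewrite ?lte_fin => X0 Y0.
- rewrite lee_fin => xy; exists x, y; split => //.
  rewrite -!ln_powR -!lnM ?posrE ?powR_gt0//.
  by rewrite ler_ln// posrE mulr_gt0 ?powR_gt0.
- by rewrite poweRyr ?gt_eqF// gt0_muley ?leye_eq// lte_fin powR_gt0.
- by rewrite poweRyr ?gt_eqF// gt0_mulye ?leye_eq// lte_fin powR_gt0.
- by rewrite !poweRyr ?gt_eqF// mulyy leye_eq.
Qed.

(** Used with [w] equal to [Omega \o Phi1] or [Omega \o Phi2], to express the integrals in the
    cost-Santaló inequality through the normalised measures [P1] and [P2]. *)
Lemma integral_expR_density {d} {T : measurableType d} {R : realType}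
    {mu P : {measure set T -> \bar R}} {w phi : T -> R} {Z : R} : 0 < Z ->
  is_density mu P (fun x => Z^-1 * w x) -> measurable_fun setT phi ->
  (\int[mu]_x (expR (phi x) * w x)%:E = Z%:E * \int[P]_x (expR (phi x))%:E)%E.
Proof.
move=> Z0 Pw mphi; have [mw w0 _] := Pw.
have mE : measurable_fun setT (fun x => expR (phi x)).
  exact: measurableT_comp.
have E0 x : 0 <= expR (phi x) by exact: expR_ge0.
rewrite (ge0_integral_density Pw mE E0) -ge0_integralZl//.
- apply: eq_integral => x _; rewrite -EFinM; congr (_%:E).
  by field; rewrite gt_eqF.
- by apply/measurable_EFinP; exact: measurable_funM.
- by move=> x _; rewrite lee_fin mulr_ge0.
- by rewrite lee_fin ltW.
Qed.

Theorem theorem7p1 (R : realType) (X1 X2 : polishMetricType R)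
  (mu1 : {measure set (borel X1) -> \bar R})
  (mu2 : {measure set (borel X2) -> \bar R})
  (A1 : set (set (borel X1))) (A2 : set (set (borel X2)))
  (hA1 : A1 `<=` measurable) (hA2 : A2 `<=` measurable)
  (a : R) (b : \bar R)
  (c : borel X1 -> borel X2 -> R)
  (hc : continuous (fun x : X1 * X2 => c x.1 x.2))
  (hcab : range (fun x : X1 * X2 => - c x.1 x.2) = ico a b)
  (lam : R) (hlam0 : 0 < lam) (hlam1 : lam < 1)
  (F : growth_fun a b)
  (hF0 : forall r, icc a b r -> 0 <= F r) (hFa : F a = 0)
  (hS : cost_santalo mu1 mu2 A1 A2 lam c F)
  (Phi1 : borel X1 -> R) (Phi2 : borel X2 -> R)
  (mPhi1 : measurable_fun setT Phi1) (mPhi2 : measurable_fun setT Phi2)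
  (hPhi1 : forall x, icc a b (Phi1 x)) (hPhi2 : forall x, icc a b (Phi2 x))
  (hPhi : forall x1 x2, lam * Phi1 x1 + (1 - lam) * Phi2 x2 >= - c x1 x2)
  (Omega : R -> R)
  (hOmega_cont : {within icc a b, continuous Omega})
  (hOmega_gt0 : forall r, icc a b r -> 0 < Omega r)
  (hOmega_noninc : {in icc a b &, {homo Omega : x y /~ x <= y}})
  (hOmega_logconc : convex_function (icc a b) (fun r : R^o => - ln (Omega r)))
  (Z1 Z2 : R)
  (hZ1 : Z1%:E = (\int[mu1]_x (Omega (Phi1 x))%:E)%E)
  (hZ2 : Z2%:E = (\int[mu2]_x (Omega (Phi2 x))%:E)%E)
  (hZ1_gt0 : 0 < Z1) (hZ2_gt0 : 0 < Z2)
  (hbalance : (\int[stieltjes F]_(r in ioc a b) (Omega r)%:E <=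
               (Z1 `^ lam * Z2 `^ (1 - lam))%:E)%E)
  (P1 : probability (borel X1) R) (P2 : probability (borel X2) R)
  (hP1 : is_density mu1 P1 (fun x => Z1^-1 * Omega (Phi1 x)))
  (hP2 : is_density mu2 P2 (fun x => Z2^-1 * Omega (Phi2 x))) :
  (forall x1 x2, 0 <= cost_Omega lam c Omega Phi1 Phi2 x1 x2) /\
  forall (nu1 : probability (borel X1) R) (nu2 : probability (borel X2) R),
    (exists f, is_density P1 nu1 f) -> (exists g, is_density P2 nu2 g) ->
    (restricted_kantorovich lam c Omega Phi1 Phi2 A1 A2 nu1 nu2 <=
     (lam / (1 - lam))%:E * relative_entropy nu1 P1 +
     relative_entropy nu2 P2)%E.
Proof.
have lam10 : 0 < 1 - lam by rewrite subr_gt0.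
have cab x1 x2 : icc a b (- c x1 x2).
  have [ac cb] : ico a b (- c x1 x2) by rewrite -hcab; exists (x1, x2).
  by split => //; exact: ltW.
have Oc x1 x2 := hOmega_gt0 _ (cab x1 x2).
have O1 x := hOmega_gt0 _ (hPhi1 x); have O2 x := hOmega_gt0 _ (hPhi2 x).
have costE x1 x2 :=
  cost_OmegaE c Omega Phi1 Phi2 hlam1 (Oc x1 x2) (O1 x1) (O2 x2).
split.

  (* Nonnegativity of the transport cost *)
  move=> x1 x2; rewrite -(pmulr_rge0 _ lam10) costE.
  have ab12 : icc a b (lam * Phi1 x1 + (1 - lam) * Phi2 x2).
    have [a1 b1] := hPhi1 x1; have [a2 b2] := hPhi2 x2.
    split; first by move: a1 a2; rewrite !lee_fin; nra.
    move: b1 b2; case: (b) => [b'| |]//; rewrite ?leey// !lee_fin; nra.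
  (* Log-concavity at weight [lam] bounds [ln (Omega _)] at the convex combination from below; as
     [- c x1 x2] lies below that combination, monotonicity of [Omega] finishes. *)
  have := hOmega_logconc (Itv01 (ltW hlam0) (ltW hlam1)) _ _
    (mem_set (hPhi1 x1)) (mem_set (hPhi2 x2)).
  rewrite -[leLHS]/(- ln (Omega (lam * Phi1 x1 + (1 - lam) * Phi2 x2))).
  rewrite -[leRHS]/(lam * - ln (Omega (Phi1 x1)) +
                    (1 - lam) * - ln (Omega (Phi2 x2))).
  have : ln (Omega (lam * Phi1 x1 + (1 - lam) * Phi2 x2)) <=
         ln (Omega (- c x1 x2)).
    rewrite ler_ln ?posrE//; last exact: hOmega_gt0.
    by apply: hOmega_noninc; rewrite ?inE.
  lra.

(* The bound for an admissible pair of potentials *)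
move=> nu1 nu2 nuP1 nuP2; apply: ge_ereal_sup.
move=> _ [phi [psi [[iphi ipsi] phipsi Lf Lg ->]]].
set f := (fun x => expR _ * _) in Lf; set g := (fun x => expR _ * _) in Lg.
have mphi : measurable_fun setT phi.
  by have /integrableP[/measurable_EFinP] := iphi.
have mpsi : measurable_fun setT psi.
  by have /integrableP[/measurable_EFinP] := ipsi.
have mkphi : measurable_fun setT (fun x => (1 - lam) / lam * phi x).
  exact: measurable_funM.
have I1 := integral_expR_density hZ1_gt0 hP1 mkphi.
have I2 := integral_expR_density hZ2_gt0 hP2 mpsi.
have [|||x [y [X Y xy]]] := poweR_le_ln hlam0 hlam1 hZ1_gt0 hZ2_gt0
    (X := (\int[mu1]_x (f x)%:E)%E) (Y := (\int[mu2]_x (g x)%:E)%E).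
- by rewrite I1 mule_gt0 ?lte_fin// integral_expR_gt0.
- by rewrite I2 mule_gt0 ?lte_fin// integral_expR_gt0.
- apply: le_trans hbalance; apply: hS.2 => //.
  + apply: (@measurable_funS _ _ _ _ (icc a b)).
    * exact: measurable_icc.
    * by move=> r [ar rb]; split => //; exact: ltW.
    * exact: (subspace_continuous_measurable_fun
        (measurable_icc a b) hOmega_cont).
  + by move=> r [ar rb]; apply/ltW/hOmega_gt0; split => //; exact: ltW.
  + move=> r s /set_mem[ar rb] /set_mem[ass sb].
    by apply: hOmega_noninc; rewrite inE; split => //; exact: ltW.
  (* In logarithms, the power [lam] turns the exponent [(1 - lam) / lam * phi] into
     [(1 - lam) * phi], so the goal is the potential constraint multiplied by [1 - lam]. *)
  + move=> x1 x2 _; have := phipsi x1 x2; rewrite -(ler_pM2l lam10) costE.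
    rewrite -ler_ln ?posrE ?mulr_gt0 ?powR_gt0 ?mulr_gt0 ?expR_gt0//.
    rewrite lnM ?posrE ?powR_gt0 ?mulr_gt0 ?expR_gt0// !ln_powR.
    rewrite !lnM ?posrE ?expR_gt0// !expRK.
    have -> : lam * ((1 - lam) / lam * phi x1 + ln (Omega (Phi1 x1))) =
      (1 - lam) * phi x1 + lam * ln (Omega (Phi1 x1)).
      by field; rewrite gt_eqF.
    lra.
have x0 : 0 < x.
  by rewrite -lte_fin -X I1 mule_gt0 ?lte_fin// integral_expR_gt0.
have y0 : 0 < y.
  by rewrite -lte_fin -Y I2 mule_gt0 ?lte_fin// integral_expR_gt0.
(* Duality with [L = ln x - ln Z1]: the exponential integral against [P1] is exactly [x / Z1]. *)
have D1 : (\int[nu1]_x ((1 - lam) / lam * phi x)%:E <=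
    relative_entropy nu1 P1 + (ln x - ln Z1)%:E)%E.
  apply: entropy_duality => //.
    by apply: (integrableZl measurableT _ iphi).
  rewrite expRB !lnK ?posrE//.
  rewrite -(@lee_pmul2l _ Z1%:E) ?lte_fin// -I1 X -EFinM lee_fin.
  by rewrite mulrCA divff ?mulr1// gt_eqF.
have D2 : (\int[nu2]_x (psi x)%:E <=
    relative_entropy nu2 P2 + (ln y - ln Z2)%:E)%E.
  apply: entropy_duality => //.
  rewrite expRB !lnK ?posrE//.
  rewrite -(@lee_pmul2l _ Z2%:E) ?lte_fin// -I2 Y -EFinM lee_fin.
  by rewrite mulrCA divff ?mulr1// gt_eqF.
have K : (\int[nu1]_x ((1 - lam) / lam * phi x)%:E =
    ((1 - lam) / lam)%:E * \int[nu1]_x (phi x)%:E)%E.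
  by rewrite -(integralZl measurableT iphi).
move: D1 D2; rewrite {}K.
have := integrable_fin_num measurableT iphi.
have := integrable_fin_num measurableT ipsi.
move=> /=; move: (integral nu1 _ _) (integral nu2 _ _) => [p| |] [q| |]// _ _.
have k0 : 0 < lam / (1 - lam) by rewrite divr_gt0.
(* The finite lower bounds [D1] and [D2] exclude the value [-oo]; an entropy equal to [+oo] makes
   the right side infinite. *)
move: (relative_entropy nu1 P1) (relative_entropy nu2 P2) => [H1| |] [H2| |]//.
- rewrite -!EFinM -!EFinD !lee_fin => D1 D2.
  have {}D1 : p <= lam / (1 - lam) * (H1 + (ln x - ln Z1)).
    have := ler_wpM2l (ltW k0) D1.
    rewrite mulrA; have -> : lam / (1 - lam) * ((1 - lam) / lam) = 1.
      by field; rewrite !gt_eqF.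
    by rewrite mul1r.
  (* After multiplication by [1 - lam], the leftover logarithms are exactly those that [xy]
     compares. *)
  have : lam / (1 - lam) * (ln x - ln Z1) + (ln y - ln Z2) <= 0.
    rewrite -(pmulr_rle0 _ lam10) mulrDr mulrA mulrCA divff ?gt_eqF// mulr1.
    lra.
  lra.
- by move=> _ _; rewrite leey.
- by move=> _ _; rewrite gt0_muley ?lte_fin// leey.
- by move=> _ _; rewrite gt0_muley ?lte_fin// leey.
Qed.
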